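(* Let $\mathcal{I}=(a,b)$ be a bounded open interval, let $u\in C^1(\overline{\mathcal{I}},\mathbb{R})$, let $\Lambda\in C^1(\mathbb{R})$ with derivative $\Lambda'$, and let $f:=\Lambda\circ u:\overline{\mathcal{I}}\to\mathbb{R}$. Let $I^i=(a^i,b^i)$, $i\in J$, be the connected components of $\mathcal{I}\setminus K_f$, where $K_f$ is the contact set of $f$. Assume that $\overline{K_f}=\overline{\widetilde K_f}$, i.e. $f>f^{**}$ on any open interval where $f^{**}$ is affine. Then, for all $\varphi\in C^\infty_c(\mathcal{I})$, $$\lim_{s\to 0}\int_{\mathcal{I}}\frac{[\Lambda(u+s\varphi)]^{**}-[\Lambda(u)]^{**}}{s}\,dx=\int_{\mathcal{I}}\mathcal{G}^{u,\varphi}\,dx,$$ where $$\mathcal{G}^{u,\varphi}(x):=\begin{cases}\varphi(a^i)\Lambda'(u(a^i))+\dfrac{\varphi(b^i)\Lambda'(u(b^i))-\varphi(a^i)\Lambda'(u(a^i))}{b^i-a^i}\,(x-a^i) & x\in I^i,\ i\in J,\\[2mm] \varphi(x)\Lambda'(u(x)) & x\in\overline{\mathcal{I}}\setminus\bigcup_{i\in J}I^i.\end{cases}$$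
   Context: For $g\in C^0(\overline{\mathcal{I}})$, $g^{**}$ denotes the convex envelope of $g$, i.e. the largest convex function on $\overline{\mathcal{I}}$ with $g^{**}\le g$. For $f\in C^1(\overline{\mathcal{I}})$: the contact set is $K_f:=\{x\in\mathcal{I}: f(x)=f^{**}(x)\}$; $K^i=[c^i,d^i]$, $i\in J_C$, is the (at most countable) family of all maximal (nondegenerate) intervals in $\overline{\mathcal{I}}$ on which $f^{**}$ is affine; $\widetilde K_f:=K_f\setminus\bigcup_{i\in J_C}K^i$. The open set $\mathcal{I}\setminus K_f$ is the union of an at most countable family of disjoint open intervals $I^i=(a^i,b^i)$, $i\in J$ (its connected components). Functions in $C^\infty_c(\mathcal{I})$ are extended by $0$ to $\overline{\mathcal{I}}$. *)

(* Defs.v *)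
From HB Require Import structures.
From mathcomp Require Import all_boot all_order all_algebra.
From mathcomp Require Import all_classical all_reals all_analysis.
Set Implicit Arguments.
Unset Strict Implicit.
Unset Printing Implicit Defensive.
Import Order.TTheory GRing.Theory Num.Theory.
Import numFieldNormedType.Exports.
Local Open Scope classical_set_scope.
Local Open Scope ring_scope.

(* Functions on the closed interval [a, b] are represented by functions R -> R;
   their values outside [a, b] are never used. *)

(* u' is only required on ]a, b[, where it must extend continuously to
   [a, b]; the value of derive1 at the endpoints depends on u outside [a, b]. *)
Definition C1_closed_itv (R : realType) (a b : R) (u : R -> R) : Prop :=
  derivable_oo_LRcontinuous u a b /\
  exists2 v : R -> R, {within `[a, b], continuous v}
    & {in `]a, b[, forall x, derive1 u x = v x}.

Definition C1_line (R : realType) (L : R -> R) : Prop :=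
  (forall x, derivable L x 1) /\ continuous (derive1 L).

(* phi is already extended by zero outside ]a, b[. *)
Definition Cinfty_c (R : realType) (a b : R) (phi : R -> R) : Prop :=
  (forall (n : nat) (x : R), derivable (derive1n n phi) x 1) /\
  compact (closure [set x | phi x != 0]) /\
  closure [set x | phi x != 0] `<=` `]a, b[.

Definition convex_minorants (R : realType) (a b : R) (g : R -> R) :
    set (R -> R) :=
  [set h | @convex_function R R^o `[a, b] h /\ {in `[a, b], forall x, h x <= g x}].

(* The pointwise supremum of the convex minorants; by convex_envelope_greatest
   it is the largest convex minorant as soon as g is bounded below. *)
Definition convex_envelope (R : realType) (a b : R) (g : R -> R) (x : R) : R :=
  sup [set h x | h in convex_minorants a b g].

Definition contact_set (R : realType) (a b : R) (f : R -> R) : set R :=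
  [set x : R | (x \in `]a, b[) /\ f x = convex_envelope a b f x].

Definition affine_on (R : realType) (c d : R) (h : R -> R) : Prop :=
  exists m q : R, {in `[c, d], forall x, h x = m * x + q}.

Definition maximal_affine_itv (R : realType) (a b : R) (h : R -> R) (c d : R) :
    Prop :=
  [/\ a <= c, c < d, d <= b, affine_on c d h &
    forall c' d' : R, a <= c' -> c' <= c -> d <= d' -> d' <= b ->
      affine_on c' d' h -> c' = c /\ d' = d].

Definition strict_contact_set (R : realType) (a b : R) (f : R -> R) : set R :=
  contact_set a b f `\`
  [set x | exists c d : R,
     maximal_affine_itv a b (convex_envelope a b f) c d /\ x \in `[c, d]].

Definition noncontact_set (R : realType) (a b : R) (f : R -> R) : set R :=
  `]a, b[ `\` contact_set a b f.

(* For x in ]a, b[ \ K_f, the interval I^i containing x is the connected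
   component of x, so that a^i and b^i are its infimum and supremum. *)
Definition Gfun (R : realType) (a b : R) (L u phi : R -> R) (x : R) : R :=
  let N := noncontact_set a b (L \o u) in
  let I := connected_component N x in
  let l := inf I in
  let r := sup I in
  let h := fun y : R => phi y * derive1 L (u y) in
  if x \in N then h l + (h r - h l) / (r - l) * (x - l) else h x.

Lemma convex_envelope_greatest (R : realType) (a b : R) (g : R -> R) :
  (exists m : R, {in `[a, b], forall x, m <= g x}) ->
  convex_minorants a b g (convex_envelope a b g) /\
  (forall h : R -> R, convex_minorants a b g h ->
    {in `[a, b], forall x, h x <= convex_envelope a b g x}).
Proof.
move=> [m hm].
have cm : convex_minorants a b g (cst m).
  by split=> // t x y _ _; rewrite convmm.
have ub x : x \in `[a, b] -> ubound [set h x | h in convex_minorants a b g] (g x).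
  by move=> xab _ [h [_ hg] <-]; exact: hg.
have ne x : [set h x | h in convex_minorants a b g] !=set0 by exists m, (cst m).
have le h : convex_minorants a b g h ->
    {in `[a, b], forall x, h x <= convex_envelope a b g x}.
  move=> ch x xab; apply: sup_upper_bound; last by exists h.
  by split; [exact: ne|exists (g x); exact: ub].
split=> //; split=> [t x y xab yab|x xab]; last by apply: ge_sup; [exact: ne|exact: ub].
apply: ge_sup; first exact: ne.
move=> _ [h ch <-]; apply: le_trans (ch.1 t x y xab yab) _.
rewrite !convRE lerD// ler_wpM2l//.
- by apply: le => //; move: xab; rewrite inE.
- by rewrite subr_ge0.
- by apply: le => //; move: yab; rewrite inE.
Qed.

(* Main.v *)
(** Write [E] for the convex envelope and [g := phi * (L' \o u)], so that
    [L \o (u + s * phi)] is [f + s * g] up to an error [o(s)] that is uniform on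
    [[a, b]].  At an interior point [x], let [l] be a supporting line of [E f] and
    [Z] the set where [f = l].  The interval [[min Z, max Z]] is a maximal affine
    interval of [E f], so the hypothesis on the contact set forces [Z] to have at
    most two points; there is therefore an affine [A] with [A = g] on [Z], and
    [A x] is the claimed limit.  The upper bound comes from the chord of
    [f + s * g] over [Z], the lower bound from the fact that [l + s * (A - e)] is
    an affine minorant of [f + s * g] for small [s].  Since the envelope is
    1-Lipschitz for the sup norm, the difference quotients are uniformly bounded,
    and dominated convergence concludes. *)
Require Import Defs.
From HB Require Import structures.
From mathcomp Require Import all_boot all_order all_algebra.
From mathcomp Require Import all_classical all_reals all_analysis.
From mathcomp Require Import measurable_realfun.
From mathcomp Require Import ring lra.
Import Order.TTheory GRing.Theory Num.Theory.
Import numFieldNormedType.Exports.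
Local Open Scope classical_set_scope.
Local Open Scope ring_scope.
Set Implicit Arguments.
Unset Strict Implicit.

(** * Convexity as real inequalities, and general properties of the envelope *)

Definition chord_convex (R : realType) (a b : R) (h : R -> R) : Prop :=
  forall x y t, a <= x <= b -> a <= y <= b -> 0 <= t <= 1 ->
    h (t * x + (1 - t) * y) <= t * h x + (1 - t) * h y.

(** Replaces the interval-typed coefficient by a real [t] with explicit bounds, a form suited to
    [lra]. *)
Lemma convex_functionP (R : realType) (a b : R) (h : R -> R) :
  @convex_function R R^o `[a, b] h <-> chord_convex a b h.
Proof.
split=> [ch x y t xab yab /andP[t0 t1]|ch t x y].
  have := ch (Itv01 t0 t1) x y.
  by rewrite !inE !convRE /=; apply; rewrite /= in_itv.
rewrite !inE /= !in_itv /= => xab yab.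
rewrite convRE; apply: (ch x y t%:inum xab yab).
by rewrite ge0 le1.
Qed.

Section envelope.
Context (R : realType) (a b : R).
Implicit Types (f g h : R -> R) (m q x y z s t : R).

Lemma chord_convex_affine m q : chord_convex a b (fun y => m * y + q).
Proof. by move=> x y t _ _ _; rewrite le_eqVlt; apply/orP; left; apply/eqP; ring. Qed.

Definition bounded_below g := exists m, forall y, a <= y <= b -> m <= g y.

Let env_spec g : bounded_below g ->
  convex_minorants a b g (convex_envelope a b g) /\
  (forall h, convex_minorants a b g h ->
    {in `[a, b], forall x, h x <= convex_envelope a b g x}).
Proof.
move=> [k kg]; apply: convex_envelope_greatest.
by exists k => y; rewrite in_itv => /kg.
Qed.

Lemma env_greatest g h : bounded_below g -> chord_convex a b h ->
  (forall y, a <= y <= b -> h y <= g y) ->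
  forall x, a <= x <= b -> h x <= convex_envelope a b g x.
Proof.
move=> /env_spec[_ +] ch hg x xab; apply; last by rewrite in_itv.
by split; [apply/convex_functionP|move=> y; rewrite in_itv => /hg].
Qed.

Lemma env_convex g : bounded_below g -> chord_convex a b (convex_envelope a b g).
Proof. by move=> /env_spec[[cg _] _]; apply/convex_functionP. Qed.

Lemma env_le g x : bounded_below g -> a <= x <= b -> convex_envelope a b g x <= g x.
Proof. by move=> /env_spec[[_ gle] _] xab; apply: gle; rewrite in_itv. Qed.

(** An envelope lowered by [C] is a convex minorant of the other function; exchanging [g] and [h]
    gives the second inequality. *)
Lemma env_dist g h C x : bounded_below g -> bounded_below h ->
  (forall y, a <= y <= b -> `|h y - g y| <= C) ->
  a <= x <= b -> `|convex_envelope a b h x - convex_envelope a b g x| <= C.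
Proof.
have key g1 h1 : bounded_below g1 -> bounded_below h1 ->
    (forall y, a <= y <= b -> `|h1 y - g1 y| <= C) -> a <= x <= b ->
    convex_envelope a b g1 x - C <= convex_envelope a b h1 x.
  move=> bg bh hC xab.
  apply: (@env_greatest h1 (fun y => convex_envelope a b g1 y - C)) => //.
    move=> y z t yab zab t01; have := env_convex bg yab zab t01; lra.
  move=> y yab; have := env_le bg yab; have := hC _ yab.
  by rewrite ler_norml => /andP[]; lra.
move=> bg bh hC xab; rewrite ler_norml.
have := key _ _ bg bh hC xab.
have : forall y, a <= y <= b -> `|g y - h y| <= C by move=> y /hC; rewrite distrC.
move=> /(key _ _ bh bg)/(_ xab); lra.
Qed.

(** Monotonicity of slopes, with denominators cleared: [y] is the convex combination of [x] and [z]
    with weight [(z - y) / (z - x)] on [x]. *)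
Lemma chord_convex_slopes h x y z : chord_convex a b h ->
  a <= x -> x < y -> y < z -> z <= b ->
  (h y - h x) * (z - y) <= (h z - h y) * (y - x).
Proof.
move=> ch ax xy yz zb.
have zx : 0 < z - x by lra.
have t01 : 0 <= (z - y) / (z - x) <= 1.
  by rewrite divr_ge0 ?ler_pdivrMr//=; lra.
have := ch x z ((z - y) / (z - x)) _ _ t01.
have -> : (z - y) / (z - x) * x + (1 - (z - y) / (z - x)) * z = y by field; lra.
have -> : (z - y) / (z - x) * h x + (1 - (z - y) / (z - x)) * h z =
  ((z - y) * h x + (y - x) * h z) / (z - x) by field; lra.
rewrite ler_pdivlMr// => H.
have : h y * (z - x) <= (z - y) * h x + (y - x) * h z by apply: H; lra.
lra.
Qed.

Lemma chord_convex_le_affine h m q c d x : chord_convex a b h ->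
  a <= c -> d <= b -> h c <= m * c + q -> h d <= m * d + q ->
  c <= x <= d -> h x <= m * x + q.
Proof.
move=> ch ac db hc hd /andP[cx xd].
have [xc|cx'] := leP x c; first by have <- : c = x by lra.
have [dx|xd'] := leP d x; first by have <- : d = x by lra.
have := chord_convex_slopes ch ac cx' xd' db.
(* The endpoint bounds, weighted by [d - x] and [x - c], add up with the slope inequality to a bound
   on [(h x - (m * x + q)) * (d - c)]. *)
have : 0 <= (m * c + q - h c) * (d - x) by rewrite mulr_ge0; lra.
have : 0 <= (m * d + q - h d) * (x - c) by rewrite mulr_ge0; lra.
move=> h1 h2 h3.
have : (h x - (m * x + q)) * (d - c) <= 0 by lra.
by rewrite pmulr_lle0 ?subr_le0// subr_gt0; lra.
Qed.

(** The slope [p] is the supremum of the slopes of chords ending at [x] from the left; every chord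
    leaving [x] to the right bounds them from above. *)
Lemma subgradient h x : chord_convex a b h -> a < x < b ->
  exists p, forall y, a <= y <= b -> h x + p * (y - x) <= h y.
Proof.
move=> ch /andP[ax xb].
pose S := [set (h x - h y) / (x - y) | y in [set y | a <= y < x]].
have Sub z : x < z -> z <= b -> ubound S ((h z - h x) / (z - x)).
  move=> xz zb _ [y /= /andP[ay yx] <-].
  rewrite ler_pdivrMr ?subr_gt0// mulrAC ler_pdivlMr ?subr_gt0//.
  exact: (chord_convex_slopes ch).
have S0 : S !=set0 by exists ((h x - h a) / (x - a)), a => //=; rewrite lexx.
have Ssup : has_sup S by split=> //; exists ((h b - h x) / (b - x)); exact: Sub.
exists (sup S) => y /andP[ay yb].
case: (ltgtP y x) => [yx|xy|->]; last by rewrite subrr mulr0 addr0.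
  have : (h x - h y) / (x - y) <= sup S.
    by apply: ub_le_sup; [case: Ssup|exists y => //=; rewrite ay].
  rewrite ler_pdivrMr ?subr_gt0//; lra.
have : sup S <= (h y - h x) / (y - x) by apply: ge_sup => //; exact: Sub.
rewrite ler_pdivlMr ?subr_gt0//; lra.
Qed.

End envelope.

(** * Contact of a function with an affine minorant *)

Section touching.
Context {R : realType} (a b : R) (ab : a < b).
Implicit Types (f g h w p : R -> R) (m q x y z s t c d e : R).

Local Notation C0 w := {within `[a, b], continuous w}.
Local Notation E := (convex_envelope a b).

Lemma continuous_within_affine m q : C0 (fun y => m * y + q).
Proof.
apply: continuous_subspaceT => x; apply: cvgD; last exact: cvg_cst.
by apply: cvgM; [exact: cvg_cst|exact: cvg_id].
Qed.

Lemma within_bounded_below f : C0 f -> bounded_below a b f.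
Proof.
move=> cf; have [c _ hc] := EVT_min (ltW ab) cf.
by exists (f c) => y yab; apply: hc; rewrite in_itv.
Qed.

(** Take for [k] the minimum of [w \max p] over the compact interval: it is positive because [p] is
    positive wherever [w] vanishes. *)
Lemma zeros_gap w p : C0 w -> C0 p -> (forall y, a <= y <= b -> 0 <= w y) ->
  (forall y, a <= y <= b -> w y = 0 -> 0 < p y) ->
  exists2 k : R, 0 < k & forall y, a <= y <= b -> w y < k -> k <= p y.
Proof.
move=> cw cp w0 p0.
have cM : C0 (w \max p) by move=> x; apply: continuous_max; [exact: cw|exact: cp].
have [c] := EVT_min (ltW ab) cM; rewrite in_itv /= => cab hc.
exists ((w \max p) c).
  rewrite lt_max; have := w0 _ cab; rewrite le_eqVlt => /predU1P[/esym/(p0 _ cab) ->|->//].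
  by rewrite orbT.
move=> y yab; have := hc y; rewrite in_itv => /(_ yab).
by rewrite [leRHS]/= le_max => /orP[/le_lt_trans/[apply]|//]; rewrite ltxx.
Qed.

(** Where [w] is below the gap [k], [p] is negative; elsewhere [w] is at least [k], which exceeds
    [s * p] for small [s]. *)
Lemma tilt_below w p : C0 w -> C0 p -> (forall y, a <= y <= b -> 0 <= w y) ->
  (forall y, a <= y <= b -> w y = 0 -> p y < 0) ->
  exists2 s0 : R, 0 < s0 &
    forall s, 0 < s <= s0 -> forall y, a <= y <= b -> s * p y <= w y.
Proof.
move=> cw cp w0 p0.
have cN : C0 (fun y => - p y) by move=> x; apply: cvgN; exact: cp.
have [|k k0 hk] := zeros_gap cw cN w0.
  by move=> y yab /(p0 _ yab); rewrite oppr_gt0.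
have [c] := EVT_max (ltW ab) cp; rewrite in_itv /= => cab hc.
have M0 : 0 < `|p c| + 1 by rewrite ltr_wpDl.
(* [p c] is the maximum of [p]; adding 1 keeps the denominator positive. *)
exists (k / (`|p c| + 1)); first by rewrite divr_gt0.
move=> s /andP[s0]; rewrite ler_pdivlMr// => sk y yab.
have [py0|py0] := leP (p y) 0.
  by rewrite (le_trans _ (w0 _ yab))// mulr_ge0_le0// ltW.
have [wk|wk] := ltP (w y) k; first by have := hk _ yab wk; lra.
apply: le_trans wk; apply: le_trans sk; rewrite ler_pM2l//.
have : p y <= p c by apply: hc; rewrite in_itv.
by have := ler_norm (p c); lra.
Qed.

Definition touches f m q y := a <= y <= b /\ f y = m * y + q.

Variables (f : R -> R) (m q : R).
Hypothesis cf : C0 f.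
Hypothesis lf : forall y, a <= y <= b -> m * y + q <= f y.

Let w y := f y - (m * y + q).
Let cw : C0 w.
Proof. by move=> x; apply: cvgB; [exact: cf|exact: continuous_within_affine]. Qed.
Let w0 y : a <= y <= b -> 0 <= w y.
Proof. by move=> yab; rewrite subr_ge0 lf. Qed.
Let w_eq0 y : w y = 0 -> f y = m * y + q.
Proof. by move/subr0_eq. Qed.

Lemma env_ge_affine y : a <= y <= b -> m * y + q <= E f y.
Proof.
move=> yab; apply: (@env_greatest _ a b f (fun y => m * y + q)) => //.
  exact: within_bounded_below.
exact: chord_convex_affine.
Qed.

Lemma env_touches y : touches f m q y -> E f y = m * y + q.
Proof.
move=> [yab fy]; apply/eqP; rewrite eq_le env_ge_affine// andbT -fy.
exact: env_le (within_bounded_below cf) yab.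
Qed.

(* [e] is the direction in which the contact point is looked for.  If there were
   none, the minorant could be tilted to a larger value at [y]: the function
   [e * (z - y) + k / 2], for small [k > 0], is positive at [y] and negative at
   all contact points [z]. *)
Lemma touches_dir e y : a <= y <= b -> E f y = m * y + q ->
  exists2 z, touches f m q z & 0 <= e * (z - y).
Proof.
move=> yab Ey; apply: contrapT => nz.
have cp : C0 (fun z => (- e) * z + e * y) by exact: continuous_within_affine.
have [|k k0 hk] := zeros_gap cw cp w0.
  move=> z zab /w_eq0 fz; rewrite mulNr addrC subr_gt0 -subr_lt0 -mulrBr ltNge.
  by apply/negP => ?; apply: nz; exists z.
have ct : C0 (fun z => e * z + (k / 2 - e * y)) by exact: continuous_within_affine.
have [|s0 s00 hs] := tilt_below cw ct w0.
  move=> z zab wz; have := hk _ zab; rewrite wz => /(_ k0); lra.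
have /hs {}hs : 0 < s0 <= s0 by rewrite s00 lexx.
have : (m + s0 * e) * y + (q + s0 * (k / 2 - e * y)) <= E f y.
  apply: (@env_greatest _ a b f (fun y' => (m + s0 * e) * y' + (q + s0 * (k / 2 - e * y)))) => //.
  - exact: within_bounded_below.
  - exact: chord_convex_affine.
  - by move=> z /hs; rewrite /w; lra.
rewrite Ey; suff : 0 < s0 * (k / 2) by lra.
by rewrite mulr_gt0// divr_gt0.
Qed.

Lemma touches_le y : a <= y <= b -> E f y = m * y + q ->
  exists2 z, touches f m q z & z <= y.
Proof.
move=> yab Ey; have [z tz] := touches_dir (-1) yab Ey.
by exists z => //; lra.
Qed.

Lemma touches_ge y : a <= y <= b -> E f y = m * y + q ->
  exists2 z, touches f m q z & y <= z.
Proof.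
move=> yab Ey; have [z tz] := touches_dir 1 yab Ey.
by exists z => //; lra.
Qed.

(** If [y] were not a contact point, the distance to [y] would be positive at all contact points,
    and [zeros_gap] would bound it below by some [k > 0]. *)
Lemma touches_closed y : a <= y <= b ->
  (forall k, 0 < k -> exists2 z, touches f m q z & `|z - y| < k) ->
  touches f m q y.
Proof.
move=> yab yZ; apply: contrapT => ny.
have cp : C0 (fun z => `|z - y|).
  by apply: continuous_subspaceT => x; apply: cvg_norm; apply: cvgB; [exact: cvg_id|exact: cvg_cst].
have [|k k0 hk] := zeros_gap cw cp w0.
  move=> z zab /w_eq0 fz; rewrite normr_gt0 subr_eq0; apply/eqP => zy.
  by apply: ny; rewrite -zy.
have [z [zab fz]] := yZ _ k0; rewrite ltNge hk//.
by rewrite /w fz subrr.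
Qed.

Lemma touches_min y : touches f m q y ->
  exists2 c, touches f m q c & forall z, touches f m q z -> c <= z.
Proof.
move=> ty.
have hi : has_inf (touches f m q).
  by split; [exists y|exists a => z [/andP[]]].
have lb z : touches f m q z -> inf (touches f m q) <= z.
  by apply: ge_inf; case: hi.
exists (inf (touches f m q)) => //; apply: touches_closed.
  apply/andP; split; last by case: (ty) => /andP[_ +] _; apply: le_trans; exact: lb.
  by apply: lb_le_inf; [exists y|move=> z [/andP[]]].
move=> k k0; have [z tz zk] := inf_adherent k0 hi.
by exists z => //; rewrite ger0_norm ?subr_ge0 ?lb//; lra.
Qed.

Lemma touches_max y : touches f m q y ->
  exists2 d, touches f m q d & forall z, touches f m q z -> z <= d.
Proof.
move=> ty.
have hs : has_sup (touches f m q).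
  by split; [exists y|exists b => z [/andP[]]].
have ub z : touches f m q z -> z <= sup (touches f m q).
  by apply: ub_le_sup; case: hs.
exists (sup (touches f m q)) => //; apply: touches_closed.
  apply/andP; split.
    by case: (ty) => /andP[+ _] _ => /le_trans; apply; exact: ub.
  by apply: ge_sup; [exists y|move=> z [/andP[]]].
move=> k k0; have [z tz zk] := sup_adherent k0 hs.
by exists z => //; rewrite distrC ger0_norm ?subr_ge0 ?ub//; lra.
Qed.

(** The affine minorant bounds the envelope from below; convexity and the values at [c] and [d]
    bound it from above. *)
Lemma env_affine_between c d y : touches f m q c -> touches f m q d ->
  c <= y <= d -> E f y = m * y + q.
Proof.
move=> tc td /andP[cy yd].
have [cab _] := tc; have [dab _] := td.
have yab : a <= y <= b by lra.
apply/eqP; rewrite eq_le env_ge_affine// andbT.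
apply: (chord_convex_le_affine (env_convex (within_bounded_below cf))
  _ _ _ _ (_ : c <= y <= d)); rewrite ?(env_touches tc) ?(env_touches td)//; lra.
Qed.

(** The interval runs from the least to the greatest contact point. An affine piece containing it
    agrees with the line at two points, hence has the same slope and intercept. *)
Lemma touches_extend c d : touches f m q c -> touches f m q d -> c < d ->
  exists c' d', [/\ c' <= c, d <= d' & maximal_affine_itv a b (E f) c' d'].
Proof.
move=> tc td cd.
have [c' tc' hc'] := touches_min tc; have [d' td' hd'] := touches_max tc.
have c'c := hc' _ tc; have dd' := hd' _ td.
have [c'ab _] := tc'; have [d'ab _] := td'.
have c'd' : c' < d' by lra.
exists c', d'; split => //; split; [by lra|by []|by lra| |].
  by exists m, q => y; rewrite in_itv; exact: env_affine_between.
move=> c2 d2 ac2 c2c' d'd2 d2b [m' [q' hm]].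
have ec' : m' * c' + q' = m * c' + q.
  by rewrite -hm ?in_itv/= ?env_touches//; lra.
have ed' : m' * d' + q' = m * d' + q.
  by rewrite -hm ?in_itv/= ?env_touches//; lra.
have mm : m' = m.
  have : (m' - m) * (d' - c') = 0 by lra.
  by move/eqP; rewrite mulf_eq0 subr_eq0 subr_eq0 [d' == c']gt_eqF// orbF => /eqP.
have qq : q' = q by move: ec'; rewrite mm => /addrI.
rewrite {}mm {}qq in hm.
(* The envelope still lies on the line at [c2] and [d2], so there are contact points at or beyond
   both; extremality of [c'] and [d'] then excludes a proper extension. *)
have [z tz zc] : exists2 z, touches f m q z & z <= c2.
  by apply: touches_le; [lra|apply: hm; rewrite in_itv/=; lra].
have [z' tz' zd] : exists2 z, touches f m q z & d2 <= z.
  by apply: touches_ge; [lra|apply: hm; rewrite in_itv/=; lra].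
by have := hc' _ tz; have := hd' _ tz'; split; lra.
Qed.

Hypothesis hK : closure (contact_set a b f) = closure (strict_contact_set a b f).

(** The middle point is in the contact set and interior to a maximal affine interval, a
    neighbourhood free of strict contact points; [hK] forbids this. *)
Lemma no_three_touches c z d : touches f m q c -> touches f m q z ->
  touches f m q d -> c < z -> z < d -> False.
Proof.
move=> tc tz td cz zd; have cd := lt_trans cz zd.
have [c' [d' [c'c dd' M]]] := touches_extend tc td cd.
have [cab _] := tc; have [dab _] := td; have [zab fz] := tz.
have : closure (contact_set a b f) z.
  apply: subset_closure; split; first by rewrite in_itv/=; lra.
  by rewrite env_touches.
rewrite hK => /(_ `]c', d'[%classic)[|k [[_ nk] kcd]].
  by apply: near_in_itvoo; rewrite in_itv/=; lra.
apply: nk; exists c', d'; split => //.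
by move: kcd; rewrite /= !in_itv/=; lra.
Qed.

Lemma touches_two c z d : touches f m q c -> touches f m q d -> c < d ->
  touches f m q z -> z = c \/ z = d.
Proof.
move=> tc td cd tz.
case: (ltgtP z c) => [zc|cz|->]; [|case: (ltgtP z d) => [zd|dz|->]|].
- by case: (no_three_touches tz tc td).
- by case: (no_three_touches tc tz td).
- by case: (no_three_touches tc td tz).
- by right.
- by left.
Qed.

(** A contact point inside []c, d[] would be a third one on the line. The component is an interval
    containing [x] but neither [c] nor [d], so it cannot reach past them. *)
Lemma noncontact_component c d x : touches f m q c -> touches f m q d -> c < x < d ->
  connected_component (noncontact_set a b f) x = `]c, d[%classic.
Proof.
move=> tc td cxd; have [cab fc] := tc; have [dab fd] := td.
have cd : c < d by lra.
have cN e : touches f m q e -> ~ noncontact_set a b f e.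
  by move=> te [eab]; apply; split => //; have [_ ->] := te; rewrite env_touches.
have sub : `]c, d[%classic `<=` noncontact_set a b f.
  move=> y; rewrite /= in_itv/= => cyd.
  split=> [|[yab fy]]; first by rewrite /= in_itv/=; lra.
  have : touches f m q y.
    by split; [lra|rewrite fy; apply: (env_affine_between tc td); lra].
  by move=> ty; apply: (no_three_touches tc ty td); lra.
apply/seteqP; split; last first.
  apply: (connected_component_max _ sub); first by rewrite /= in_itv/=.
  by apply/connected_intervalP; exact: interval_is_interval.
have iv : is_interval (connected_component (noncontact_set a b f) x).
  exact/connected_intervalP/component_connected.
have xC : connected_component (noncontact_set a b f) x x.
  by apply: connected_component_refl; apply: sub; rewrite /= in_itv.
have nC e : touches f m q e -> ~ connected_component (noncontact_set a b f) x e.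
  by move=> te /connected_component_sub; exact: cN.
move=> y yC; rewrite /= in_itv/=; apply/andP; split; rewrite ltNge; apply/negP => h.
- by apply: (nC _ tc); apply: (iv y x) => //; lra.
- by apply: (nC _ td); apply: (iv x y) => //; lra.
Qed.

End touching.

(** * Uniform first-order expansion of a C1 function *)

Section first_order.
Context {R : realType}.
Implicit Types (L : R -> R).

Lemma derivable_mean_value L : (forall x, derivable L x 1) ->
  forall v h, exists2 xi : R, `|xi - v| <= `|h| & L (v + h) - L v = derive1 L xi * h.
Proof.
move=> dL.
have cL : continuous L.
  by move=> x; apply/differentiable_continuous/derivable1_diffP.
have idL (x : R) : is_derive x (1 : R) L (derive1 L x) by rewrite derive1E; apply/derivableP.
have mvt (x y : R) : x <= y -> exists2 xi : R, x <= xi <= y & L y - L x = derive1 L xi * (y - x).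
  move=> xy; have [|xi] := MVT_segment xy (fun z _ => idL z).
    exact: continuous_subspaceT.
  by rewrite in_itv; exists xi.
move=> v h; have [h0|h0] := leP 0 h.
  have [|xi xib ->] := mvt v (v + h); first by lra.
  by exists xi; [rewrite !ger0_norm; lra|congr (_ * _); lra].
have [|xi xib e] := mvt (v + h) v; first by lra.
by exists xi; [rewrite !ler0_norm; lra|lra].
Qed.

(** The mean value theorem turns the remainder into an oscillation of the derivative; compactness of
    [[-M, M]] makes the radius independent of [v]. *)
Lemma C1_line_expansion L : C1_line L -> forall M e, 0 < e ->
  exists2 r : R, 0 < r & forall v h, `|v| <= M -> `|h| < r ->
    `|L (v + h) - L v - derive1 L v * h| <= e * `|h|.
Proof.
move=> [dL cL'] M e e0.
pose P h v := `|L (v + h) - L v - derive1 L v * h| <= e * `|h|.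
have /compact_near_coveringP/(_ R (nbhs 0) P _) := @segment_compact _ (- M) M.
case=> [v _|r /= r0 hr].
  have e20 : 0 < e / 2 by rewrite divr_gt0.
  have /cvgrPdist_lt/(_ _ e20)[d /= d0 hd] := cL' v.
  have d20 : 0 < d / 2 by rewrite divr_gt0.
  (* Halving [d] keeps the base point [v'] and the mean value point [xi] both within [d] of [v], so
     each contributes less than [e / 2]. *)
  exists (ball v (d / 2), ball 0 (d / 2)); first by split; exact: nbhsx_ballx.
  move=> [v' h] /= [+ +]; rewrite /ball /= sub0r normrN => vv' hd2.
  rewrite /P; have [xi xiv ->] := derivable_mean_value dL v' h.
  rewrite -mulrBl normrM ler_wpM2r//.
  have := hd v' _; have := hd xi _; rewrite /= => h1 h2.
  have := ler_normB (derive1 L v - derive1 L v') (derive1 L v - derive1 L xi).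
  have -> : derive1 L v - derive1 L v' - (derive1 L v - derive1 L xi) =
    derive1 L xi - derive1 L v' by ring.
  have {}h2 : `|derive1 L v - derive1 L v'| < e / 2 by apply: h2; lra.
  suff h3 : `|derive1 L v - derive1 L xi| < e / 2 by lra.
  apply: h1; rewrite distrC.
  have := ler_normD (xi - v') (v' - v); rewrite subrKA (distrC v' v); lra.
exists r => // v h vM hr'; apply: (hr h) => /=; first by rewrite sub0r normrN.
by rewrite in_itv/= -ler_norml.
Qed.

End first_order.

(** * Pointwise first-order expansion of the envelope *)

Section expansion.
Context {R : realType} (a b : R) (ab : a < b).
Implicit Types (f g h w F : R -> R) (m q x y z s t c d e : R).

Local Notation C0 w := {within `[a, b], continuous w}.
Local Notation E := (convex_envelope a b).

(** The threshold [s0] is chosen before [F], so it depends only on the unperturbed data. The case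
    [c = d = x] is allowed and serves contact points. *)
Lemma env_expansion_right f g m q al be c d x e : C0 f -> C0 g ->
  (forall y, a <= y <= b -> m * y + q <= f y) ->
  (forall z, touches a b f m q z -> g z = al * z + be) ->
  touches a b f m q c -> touches a b f m q d -> c <= x <= d -> 0 < e ->
  exists2 s0 : R, 0 < s0 & forall s F, 0 < s <= s0 -> bounded_below a b F ->
    (forall y, a <= y <= b -> `|F y - (f y + s * g y)| <= e * s) ->
    `|E F x - ((m * x + q) + s * (al * x + be))| <= 2 * e * s.
Proof.
move=> cf cg lf gA tc td cxd e0.
have cw : C0 (fun y => f y - (m * y + q)).
  by move=> y; apply: cvgB; [exact: cf|exact: continuous_within_affine].
(* The shift by [e] makes this function equal to [- e] at contact points, as [tilt_below] requires.
   The error of [F] costs another [e * s], whence the factor 2 in the lower bound. *)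
have cp : C0 (fun y => al * y + (be - e) - g y).
  by move=> y; apply: cvgB; [exact: continuous_within_affine|exact: cg].
have [||s0 s00 hs0] := tilt_below ab cw cp.
- by move=> y yab; rewrite subr_ge0 lf.
- by move=> y yab /subr0_eq fy; rewrite (gA y) //; lra.
exists s0 => // s F ss0 bF hF; have /andP[s_gt0 _] := ss0.
have es0 : 0 < e * s by rewrite mulr_gt0.
have [cab fc] := tc; have [dab fd] := td.
have lower : (m + s * al) * x + (q + s * be - 2 * e * s) <= E F x.
  apply: (@env_greatest _ a b F (fun y => (m + s * al) * y + (q + s * be - 2 * e * s))) => //.
  - exact: chord_convex_affine.
  - move=> y yab; have := hs0 _ ss0 _ yab; have := hF _ yab.
    by rewrite ler_norml => /andP[]; lra.
  - lra.
have upper : E F x <= (m + s * al) * x + (q + s * be + e * s).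
  have le z : touches a b f m q z -> E F z <= (m + s * al) * z + (q + s * be + e * s).
    move=> tz; have [zab fz] := tz; apply: (le_trans (env_le bF zab)).
    by have := hF _ zab; rewrite fz (gA _ tz) ler_norml => /andP[]; lra.
  by apply: (chord_convex_le_affine (env_convex bF) _ _ (le _ tc) (le _ td) cxd); lra.
by rewrite ler_norml; lra.
Qed.

(** For negative [s], the right-sided result applies to [- s] and [- g], with interpolant
    coefficients [- al] and [- be]. *)
Lemma env_expansion f g m q al be c d x e : C0 f -> C0 g ->
  (forall y, a <= y <= b -> m * y + q <= f y) ->
  (forall z, touches a b f m q z -> g z = al * z + be) ->
  touches a b f m q c -> touches a b f m q d -> c <= x <= d -> 0 < e ->
  exists2 s0 : R, 0 < s0 & forall s F, s != 0 -> `|s| <= s0 -> bounded_below a b F ->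
    (forall y, a <= y <= b -> `|F y - (f y + s * g y)| <= e * `|s|) ->
    `|E F x - ((m * x + q) + s * (al * x + be))| <= 2 * e * `|s|.
Proof.
move=> cf cg lf gA tc td cxd e0.
have [s1 s10 h1] := env_expansion_right cf cg lf gA tc td cxd e0.
have cNg : C0 (fun y => - g y) by move=> y; apply: cvgN; exact: cg.
have NgA z : touches a b f m q z -> - g z = - al * z + - be by move=> /gA ->; ring.
have [s2 s20 h2] := env_expansion_right cf cNg lf NgA tc td cxd e0.
exists (Num.min s1 s2); first by rewrite lt_min s10.
move=> s F sN0 + bF hF; rewrite le_min => /andP[ss1 ss2].
have [s0|s0|s0] := ltgtP s 0; last by rewrite s0 eqxx in sN0.
  rewrite ltr0_norm// in ss2 hF *.
  have -> : s * (al * x + be) = (- s) * (- al * x + - be) by ring.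
  apply: h2 => //; first by lra.
  by move=> y /hF; rewrite mulrNN.
rewrite gtr0_norm// in ss1 hF *.
by apply: h1 => //; lra.
Qed.

(* [Gfun a b L u phi] with [f := L \o u] and [g := phi * (L' \o u)]. *)
Definition contact_interp f g x :=
  let N := noncontact_set a b f in
  let I := connected_component N x in
  let l := inf I in
  let r := sup I in
  if x \in N then g l + (g r - g l) / (r - l) * (x - l) else g x.

(** What remains is to find the affine interpolant of [g] on the contact points of a supporting line
    at [x], and to identify its value at [x]. *)
Lemma env_derivative f g x e : C0 f -> C0 g ->
  closure (contact_set a b f) = closure (strict_contact_set a b f) ->
  a < x < b -> 0 < e ->
  exists2 s0 : R, 0 < s0 & forall s F, s != 0 -> `|s| <= s0 -> bounded_below a b F ->
    (forall y, a <= y <= b -> `|F y - (f y + s * g y)| <= e * `|s|) ->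
    `|E F x - (E f x + s * contact_interp f g x)| <= 2 * e * `|s|.
Proof.
move=> cf cg hK xab e0.
have bf := within_bounded_below ab cf.
have [m hm] := subgradient (env_convex bf) xab.
pose q := E f x - m * x.
have Ex : E f x = m * x + q by rewrite /q addrC subrK.
have lf y : a <= y <= b -> m * y + q <= f y.
  by move=> yab; apply: le_trans (env_le bf yab); have := hm _ yab; rewrite /q; lra.
have xab' : a <= x <= b by lra.
suff [c [d [al [be [tc td cxd gA Gx]]]]] : exists c d al be,
    [/\ touches a b f m q c, touches a b f m q d, c <= x <= d,
      (forall z, touches a b f m q z -> g z = al * z + be) &
      contact_interp f g x = al * x + be].
  have [s0 s00 hs0] := env_expansion cf cg lf gA tc td cxd e0.
  by exists s0 => // s F sN0 ss0 bF hF; rewrite Gx Ex; exact: hs0.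
have chord c d : touches a b f m q c -> touches a b f m q d -> c < d ->
    let al := (g d - g c) / (d - c) in
    forall z, touches a b f m q z -> g z = al * z + (g c - al * c).
  move=> tc td cd /= z tz.
  by have [->|->] := touches_two ab cf lf hK tc td cd tz; field; rewrite subr_eq0 gt_eqF.
(* Off the contact set, [x] lies strictly between two contact points of the line, which are the
   endpoints of its component. *)
rewrite /contact_interp; case: ifPn => [|xN].
  rewrite inE => -[_ nK].
  have [c tc cx] := touches_le ab cf lf xab' Ex.
  have [d td xd] := touches_ge ab cf lf xab' Ex.
  have nx z : touches a b f m q z -> z != x.
    move=> [_ fz]; apply/eqP => zx; apply: nK; split; first by rewrite in_itv.
    by rewrite -zx in Ex *; rewrite fz Ex.
  have cx' : c < x by rewrite lt_neqAle nx.
  have xd' : x < d by rewrite lt_neqAle eq_sym nx.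
  have cd := lt_trans cx' xd'.
  rewrite (noncontact_component ab cf lf hK tc td); last by lra.
  rewrite sup_itv// inf_itv//.
  exists c, d, ((g d - g c) / (d - c)), (g c - (g d - g c) / (d - c) * c).
  split => //; [by lra|exact: chord|by ring].
have tx : touches a b f m q x.
  split => //; rewrite -Ex; apply: contrapT => nfx; move/negP: xN; apply.
  by rewrite inE; split; [rewrite /= in_itv|case].
(* At a contact point any interpolant has value [g x] at [x]; it is constant if [x] is the only
   point of contact with the line, and a chord of [g] otherwise. *)
have [[z tz zx]|nz] := pselect (exists2 z, touches a b f m q z & z != x); last first.
  exists x, x, 0, (g x); split => //; [by lra| |by ring].
  move=> z tz; have [->|zx] := eqVneq z x; first by ring.
  by case: nz; exists z.
have [al [be gA]] : exists al be, forall z, touches a b f m q z -> g z = al * z + be.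
  move: zx; rewrite neq_lt => /orP[zx|xz].
    by do 2 eexists; exact: chord tz tx zx.
  by do 2 eexists; exact: chord tx tz xz.
by exists x, x, al, be; split => //; [lra|exact: gA].
Qed.

(** Sublevel sets of a convex function are intervals. The passage to [- h] turns them into preimages
    of the generating rays [[r, +oo[]. *)
Lemma chord_convex_measurable h : chord_convex a b h ->
  measurable_fun `]a, b[ h.
Proof.
move=> ch; rewrite -[h]opprK; apply/measurable_funN.
apply: (measurability (@RGenCInfty.G R)) => [|/= _ [_] [r] -> <-].
  exact: RGenCInfty.measurableE.
apply: is_interval_measurable => y z /=.
rewrite !in_itv/= !andbT => -[yab ry] [zab rz] x /andP[yx xz].
have xab : a < x < b by lra.
split; first by rewrite in_itv.
rewrite in_itv/= andbT lerNr.
have := @chord_convex_le_affine _ a b h 0 (- r) y z x ch.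
by rewrite !mul0r !add0r; apply; rewrite 1?lerNr//; lra.
Qed.

End expansion.

(** * Passage to the limit under the integral *)

Section limit.
Context {R : realType} (a b : R) (ab : a < b).
Implicit Types (e r s x y M : R).

Local Notation C0 w := {within `[a, b], continuous w}.
Local Notation E := (convex_envelope a b).

Lemma within_bounded (w : R -> R) : C0 w ->
  exists2 M : R, 0 < M & forall y, a <= y <= b -> `|w y| <= M.
Proof.
move=> cw.
have cn : C0 (fun y => `|w y|) by move=> y; apply: cvg_norm; exact: cw.
have [c _ hc] := EVT_max (ltW ab) cn.
exists (`|w c| + 1); first by rewrite ltr_wpDl.
move=> y yab; rewrite (le_trans (hc y _)) ?in_itv//=.
by rewrite lerDl.
Qed.

Lemma C1_line_expansion_comp (L u phi : R -> R) : C1_line L -> C0 u -> C0 phi ->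
  forall e, 0 < e -> exists2 r : R, 0 < r & forall s, `|s| <= r ->
    forall y, a <= y <= b ->
      `|L (u y + s * phi y) - (L (u y) + s * (phi y * derive1 L (u y)))| <= e * `|s|.
Proof.
move=> L1 cu cphi e e0.
have [M M0 hM] := within_bounded cu.
have [P P0 hP] := within_bounded cphi.
have [r r0 hr] := C1_line_expansion L1 M (divr_gt0 e0 P0).
(* The factor 2 gives the strict bound on the increment [s * phi y]; the tolerance [e / P] above
   absorbs the size of [phi]. *)
exists (r / (2 * P)); first by rewrite divr_gt0// mulr_gt0.
move=> s; rewrite ler_pdivlMr ?mulr_gt0// => sr y yab.
have sP : `|s * phi y| <= `|s| * P by rewrite normrM ler_wpM2l ?hP.
have := hr _ _ (hM _ yab) (_ : `|s * phi y| < r).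
have -> : L (u y + s * phi y) - L (u y) - derive1 L (u y) * (s * phi y) =
  L (u y + s * phi y) - (L (u y) + s * (phi y * derive1 L (u y))) by ring.
move=> H; apply: le_trans (H _) _; first by lra.
by rewrite -mulrA ler_pM2l// mulrC ler_pdivrMr.
Qed.

(** Only the uniform expansion of [F s] as [f + s * g] matters here, so the composition structure is
    abstracted away. *)
Lemma env_quotient_integral (f g : R -> R) (F : R -> R -> R) : C0 f -> C0 g ->
  closure (contact_set a b f) = closure (strict_contact_set a b f) ->
  (forall s, C0 (F s)) ->
  (forall e, 0 < e -> exists2 r : R, 0 < r & forall s, `|s| <= r ->
    forall y, a <= y <= b -> `|F s y - (f y + s * g y)| <= e * `|s|) ->
  (fun s : R => \int[@lebesgue_measure R]_(x in `]a, b[) ((E (F s) x - E f x) / s)) @ 0^'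
  --> \int[@lebesgue_measure R]_(x in `]a, b[) contact_interp a b f g x.
Proof.
move=> cf cg hK cF hF.
have bf := within_bounded_below ab cf.
have bF s := within_bounded_below ab (cF s).
have [M M0 hM] := within_bounded cg.
(* Tolerance 1 in the expansion yields the constant dominating function [1 + M] for [|s| <= r]. *)
have [r r0 hr] := hF _ ltr01.
have dom s x : s != 0 -> `|s| <= r -> a <= x <= b -> `|(E (F s) x - E f x) / s| <= 1 + M.
  move=> sN0 sr xab; rewrite normrM normfV ler_pdivrMr ?normr_gt0//.
  apply: env_dist => // y yab.
  have -> : F s y - f y = (F s y - (f y + s * g y)) + s * g y by ring.
  apply: le_trans (ler_normD _ _) _; rewrite mulrDl lerD ?hr//.
  by rewrite normrM mulrC ler_wpM2r ?hM.
have meas s : measurable_fun `]a, b[ (fun x => (E (F s) x - E f x) / s).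
  apply: measurable_funM; last exact: measurable_cst.
  by apply: measurable_funB; apply: chord_convex_measurable; exact: env_convex.
have lim (t : R^nat) x : (forall n, t n != 0) -> t n @[n --> \oo] --> 0 -> a < x < b ->
    (E (F (t n)) x - E f x) / t n @[n --> \oo] --> contact_interp a b f g x.
  move=> t0 ct xab; apply/cvgrPdist_le => e e0.
  have e20 : 0 < e / 2 by rewrite divr_gt0.
  have [s1 s10 h1] := env_derivative ab cf cg hK xab e20.
  have [s2 s20 h2] := hF _ e20.
  have m0 : 0 < Num.min s1 s2 by rewrite lt_min s10.
  move/cvgrPdist_le : ct => /(_ _ m0); apply: filterS => n.
  rewrite sub0r normrN le_min => /andP[ts1 ts2].
  have := h1 _ (F (t n)) (t0 n) ts1 (bF _) (h2 _ ts2).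
  rewrite [2 * _]mulrC divfK// -ler_pdivrMr ?normr_gt0// -normfV -normrM.
  rewrite distrC mulrBl; congr (`|_| <= _).
  by field.
(* Dominated convergence is about sequences, so the limit is tested along nonzero sequences tending
   to 0, shifted by [N] to enter the range where the domination holds. *)
apply/cvgr_dnbhsP => t [t0 ct].
have [N _ hN] : \forall n \near \oo, `|t n| <= r.
  by move/cvgrPdist_le : ct => /(_ _ r0); apply: filterS => n; rewrite sub0r normrN.
rewrite -(cvg_shiftn N).
have mI : measurable `]a, b[%classic by exact: measurable_itv.
have finI : (@lebesgue_measure R `]a, b[%classic < +oo)%E.
  by rewrite lebesgue_measure_itv/= lte_fin ab -EFinB ltry.
have ig : (@lebesgue_measure R).-integrable `]a, b[ (EFin \o cst (1 + M)).
  apply: measurable_bounded_integrable => //.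
  by exists `|1 + M|; split => // y My z _ /=; exact: ltW.
have mf_ n : measurable_fun `]a, b[ (fun x => ((E (F (t (n + N)%N)) x - E f x) / t (n + N)%N)%:E).
  by apply/measurable_EFinP; exact: meas.
have f_f x : `]a, b[%classic x ->
  (fun n => ((E (F (t (n + N)%N)) x - E f x) / t (n + N)%N)%:E) @ \oo --> (contact_interp a b f g x)%:E.
  rewrite /= in_itv/= => xab; apply: cvg_EFin; first exact: nearW.
  rewrite (cvg_shiftn N (fun n => (E (F (t n)) x - E f x) / t n)).
  exact: lim.
have absfg n x : `]a, b[%classic x ->
  (`|((E (F (t (n + N)%N)) x - E f x) / t (n + N)%N)%:E| <= (EFin \o cst (1 + M)%R) x)%E.
  rewrite /= in_itv/= => xab; rewrite lee_fin; apply: dom => //; last by lra.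
  by apply: hN => /=; rewrite leq_addl.
(* The limit is measurable as a pointwise limit of measurable functions. *)
have mG := emeasurable_fun_cvg _ _ mf_ f_f.
have [iG _ cG] := @dominated_convergence _ _ _ (@lebesgue_measure R) _ mI _ _ _ mf_ mG
  (aeW (@lebesgue_measure R) f_f) ig (aeW (@lebesgue_measure R) (fun x n => @absfg n x)).
(* Finiteness of the limit integral allows the return from extended reals to reals. *)
have finG := @integrable_fin_num _ _ _ (@lebesgue_measure R) _ mI _ iG.
by apply: fine_cvg; rewrite /Rintegral fineK//; exact: cG.
Qed.

End limit.

Theorem theorem2p5 (R : realType) (a b : R) (hab : a < b)
    (u : R -> R) (hu : C1_closed_itv a b u)
    (L : R -> R) (hL : C1_line L)
    (hK : closure (contact_set a b (L \o u)) =
          closure (strict_contact_set a b (L \o u)))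
    (phi : R -> R) (hphi : Cinfty_c a b phi) :
  (fun s : R =>
     \int[@lebesgue_measure R]_(x in `]a, b[)
       ((convex_envelope a b (fun y => L (u y + s * phi y)) x
         - convex_envelope a b (L \o u) x) / s)) @ 0^'
  --> \int[@lebesgue_measure R]_(x in `]a, b[) Gfun a b L u phi x.
Proof.
have cL : continuous L.
  by move=> x; apply/differentiable_continuous/derivable1_diffP; case: hL.
have cu : {within `[a, b], continuous u}.
  by case: hu => /derivable_oo_LRcontinuous_within.
have cphi : {within `[a, b], continuous phi}.
  apply: continuous_subspaceT => x.
  by apply/differentiable_continuous/derivable1_diffP; case: hphi => /(_ 0%N x).
have comp (K v : R -> R) : continuous K -> {within `[a, b], continuous v} ->
    {within `[a, b], continuous (K \o v)}.
  move=> cK cv y; apply: (@continuous_comp (subspace `[a, b]) R R v K y (cv y)).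
  exact: cK.
(* With these [f] and [g], [contact_interp] unfolds to the same expression as [Gfun]. *)
apply: (env_quotient_integral hab (f := L \o u)
  (g := fun y => phi y * derive1 L (u y)) (F := fun s y => L (u y + s * phi y))) => //.
- exact: comp.
- by move=> y; apply: cvgM; [exact: cphi|exact: (comp _ _ hL.2 cu)].
- move=> s; apply: (comp L (fun y => u y + s * phi y)) => // y.
  by apply: cvgD; [exact: cu|apply: cvgM; [exact: cvg_cst|exact: cphi]].
- exact: C1_line_expansion_comp.
Qed.
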